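(* Let $f:\mathbb{R}^{n_x}\times\mathbb{R}\times\mathbb{R}\to\mathbb{R}^{n_x}$, $(x,\mu,u)\mapsto f(x,\mu,u)$, be continuously differentiable, let $a\in\mathbb{R}$, and consider the system $$\dot x=f(x,\mu,au),\qquad \dot\mu=u,$$ with state $(x,\mu)\in\mathbb{R}^{n_x}\times\mathbb{R}$ and scalar control input $u\in\mathbb{R}$. Let $(x_{\mathrm{eq}},\mu_{\mathrm{eq}})$ be an equilibrium for $u=0$, i.e. $f(x_{\mathrm{eq}},\mu_{\mathrm{eq}},0)=0$, and let $$f_x=\partial_1f(x_{\mathrm{eq}},\mu_{\mathrm{eq}},0)\in\mathbb{R}^{n_x\times n_x},\quad f_\mu=\partial_2f(x_{\mathrm{eq}},\mu_{\mathrm{eq}},0)\in\mathbb{R}^{n_x\times1},\quad f_u=\partial_3f(x_{\mathrm{eq}},\mu_{\mathrm{eq}},0)\in\mathbb{R}^{n_x\times1},$$ $$R_u=[f_u,f_xf_u,\ldots,f_x^{n_x-1}f_u]\in\mathbb{R}^{n_x\times n_x},\qquad R_\mu=[f_\mu,f_xf_\mu,\ldots,f_x^{n_x-1}f_\mu]\in\mathbb{R}^{n_x\times n_x}.$$ If the matrix $a f_xR_u+R_\mu$ is regular (i.e. invertible), then the equilibrium $(x_{\mathrm{eq}},\mu_{\mathrm{eq}})$ of the system is controllable.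
   Context: A linear constant-coefficient system $\dot z=Mz+Nu$ with $M\in\mathbb{R}^{n\times n}$, $N\in\mathbb{R}^{n\times m}$ is called controllable if the controllability matrix $[N,MN,\ldots,M^{n-1}N]$ has full rank $n$. An equilibrium of a nonlinear control system $\dot z=F(z,u)$ at $z=z_{\mathrm{eq}}$, $u=0$ is called controllable if its linearization there, $(M,N)=(\partial_1F(z_{\mathrm{eq}},0),\partial_2F(z_{\mathrm{eq}},0))$, is controllable. Here $z=(x,\mu)$ and $F(z,u)=(f(x,\mu,au),u)$. *)

(* Defs.v *)
From HB Require Import structures.
From mathcomp Require Import all_boot all_order all_algebra.
From mathcomp Require Import boolp classical_sets reals topology normedtype derive.

Set Implicit Arguments.
Unset Strict Implicit.
Unset Printing Implicit Defensive.

Import Order.TTheory GRing.Theory Num.Theory.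
Import numFieldNormedType.Exports.

Local Open Scope classical_set_scope.
Local Open Scope ring_scope.

(* The second clause is continuity of p |-> 'd f p for the operator norm. *)
Definition continuously_differentiable (R : realType) (V W : normedModType R)
    (f : V -> W) : Prop :=
  (forall p : V, differentiable f p) /\
  (forall (p : V) (e : R), 0 < e ->
     \forall q \near p, forall v : V, `|'d f q v - 'd f p v| <= e * `|v|).

(* The library's [jacobian] acts on row vectors and is the transpose of the
   usual Jacobian matrix; this is the m x n one, acting on columns. *)
Definition cjacobian (R : realType) (n m : nat) (g : 'cV[R]_n -> 'cV[R]_m)
    (x : 'cV[R]_n) : 'M[R]_(m, n) :=
  \matrix_(i < m, j < n) ('d g x (delta_mx j 0)) i 0.

Definition controllability_mx (R : realType) (n m : nat)
    (M : 'M[R]_n) (N : 'M[R]_(n, m)) : 'M[R]_(n, \sum_(k < n) m) :=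
  \mxrow_(k < n) (M ^+ k *m N).

Definition controllable (R : realType) (n m : nat)
    (M : 'M[R]_n) (N : 'M[R]_(n, m)) : Prop :=
  \rank (controllability_mx M N) = n.

Definition equilibrium (R : realType) (n m : nat)
    (F : 'cV[R]_n -> 'cV[R]_m -> 'cV[R]_n) (z : 'cV[R]_n) : Prop :=
  F z 0 = 0.

Definition controllable_equilibrium (R : realType) (n m : nat)
    (F : 'cV[R]_n -> 'cV[R]_m -> 'cV[R]_n) (z : 'cV[R]_n) : Prop :=
  equilibrium F z /\
  controllable (cjacobian (fun z' => F z' 0) z) (cjacobian (fun u => F z u) 0).

(* F(z, u) = (f(x, mu, a u), u) with z = (x, mu) stacked as a column and the
   scalar input u seen as a vector of size 1. *)
Definition extended_system (R : realType) (nx : nat)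
    (f : 'cV[R]_nx -> R -> R -> 'cV[R]_nx) (a : R)
    (z : 'cV[R]_(nx + 1)) (u : 'cV[R]_1) : 'cV[R]_(nx + 1) :=
  col_mx (f (usubmx z) (dsubmx z 0 0) (a * u 0 0)) u.

(* [b, A b, ..., A^(n-1) b]: the controllability matrix of (A, b) for a single
   column b, typed as a square matrix. *)
Definition krylov_mx (R : realType) (n : nat) (A : 'M[R]_n) (b : 'cV[R]_n) :
    'M[R]_n :=
  \matrix_(i < n, j < n) (A ^+ j *m b) i 0.

(* Main.v *)
(** Write [A = f_x] and [b = a f_u]. The linearization at the equilibrium is
    [M = [[A, f_mu], [0, 0]]], [N = [b; 1]], so that [M N = [w; 0]] with
    [w = A b + f_mu], and [M^(k+1) N = [A^k w; 0]]. The controllability matrix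
    is thus block triangular, with diagonal blocks [1] and the Krylov matrix of
    [(A, w)], which is [a f_x R_u + R_mu] since [A] commutes with its powers. *)
Require Import Defs.
From HB Require Import structures.
From mathcomp Require Import all_boot all_order all_algebra.
From mathcomp Require Import boolp classical_sets functions reals topology normedtype.
From mathcomp Require Import derive.

Import Order.TTheory GRing.Theory Num.Theory.
Import numFieldNormedType.Exports.

Local Open Scope classical_set_scope.
Local Open Scope ring_scope.

(** Column [j] of the Krylov matrix is [A ^+ j *m b], so the product can be checked one column at a
    time. *)
Lemma mul_row_krylov_mx_eq0 (R : realType) (n : nat) (A : 'M[R]_n)
    (b : 'cV[R]_n) (v : 'rV[R]_n) :
  (forall k, (k < n)%N -> v *m (A ^+ k *m b) = 0) -> v *m krylov_mx A b = 0.
Proof.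
move=> vA0; apply/rowP => j; rewrite mxE [RHS]mxE.
transitivity ((v *m (A ^+ j *m b)) 0 0); last by rewrite vA0// mxE.
by rewrite [RHS]mxE; apply: eq_bigr => i _; rewrite [X in _ * X]mxE.
Qed.

Lemma krylov_mxD (R : realType) (n : nat) (A : 'M[R]_n) (b c : 'cV[R]_n) :
  krylov_mx A (b + c) = krylov_mx A b + krylov_mx A c.
Proof. by apply/matrixP => i j; rewrite mxE mulmxDr !mxE. Qed.

Lemma krylov_mxZ (R : realType) (n : nat) (A : 'M[R]_n) (k : R) (b : 'cV[R]_n) :
  krylov_mx A (k *: b) = k *: krylov_mx A b.
Proof. by apply/matrixP => i j; rewrite mxE -scalemxAr !mxE. Qed.

Lemma krylov_mxM (R : realType) (n : nat) (A : 'M[R]_n) (b : 'cV[R]_n) :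
  krylov_mx A (A *m b) = A *m krylov_mx A b.
Proof.
apply/matrixP => i j; rewrite mxE mulmxA.
have -> : A ^+ j *m A = A *m A ^+ j by rewrite !mulmxE -exprSr exprS.
by rewrite -mulmxA !mxE; apply: eq_bigr => l _; rewrite [in RHS]mxE.
Qed.

Lemma controllable_integrator (R : realType) (n : nat) (A : 'M[R]_n)
    (b c : 'cV[R]_n) :
  krylov_mx A (A *m b + c) \in unitmx ->
  controllable (block_mx A c 0 0) (col_mx b (1%:M : 'M_1)).
Proof.
set M := block_mx _ _ _ _; set N := col_mx _ _; set w := _ + c => uW.
have MN k : M ^+ k.+1 *m N = col_mx (A ^+ k *m w) 0.
  elim: k => [|k IHk].
    by rewrite expr1 expr0 mul1mx mul_block_col !mul0mx mulmx1 addr0.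
  rewrite exprS -mulmxE -mulmxA IHk mul_block_col mulmx0 !mul0mx !addr0.
  by rewrite mulmxA mulmxE -exprS.
(* Full row rank amounts to a trivial left kernel: [v] is a row vector that annihilates every block
   [M ^+ k *m N]. *)
apply/eqP; rewrite -[_ == _]/(row_free _); apply: inj_row_free => v.
rewrite mul_mxrow -mxrow0 => /eq_mxrowP vC0.
have {}vC0 k : (k < n + 1)%N -> v *m (M ^+ k *m N) = 0.
  by move=> kn; apply: (vC0 (Ordinal kn)).
(* The blocks with exponents 1 to [n] have zero last entry, so they constrain only the left part of
   [v]. It annihilates the invertible [krylov_mx A w]; the size [n + 1] leaves room for exactly
   these [n] exponents. *)
have v0 : lsubmx v = 0.
  apply: (row_free_inj (A := krylov_mx A w)); first by rewrite row_free_unit.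
  rewrite mul0mx; apply: mul_row_krylov_mx_eq0 => k kn.
  have kn1 : (k.+1 < n + 1)%N by rewrite addn1 ltnS.
  have := vC0 _ kn1; rewrite MN -[v in v *m _]hsubmxK mul_row_col mulmx0.
  by rewrite addr0.
(* The remaining block is [N] itself. With the left part of [v] gone, its bottom entry 1 isolates
   the last entry of [v]. *)
have n_gt0 : (0 < n + 1)%N by rewrite addn1.
have := vC0 _ n_gt0.
rewrite expr0 mul1mx -[v in v *m _]hsubmxK mul_row_col mulmx1 v0 mul0mx add0r.
by move=> v1; rewrite -[v]hsubmxK v0 v1 row_mx0.
Qed.

(** In finite dimension, [g] is a finite sum of coordinate functions times the fixed vectors
    [g (delta_mx i j)]. It is therefore differentiable, hence continuous, and a continuous linear
    map is its own differential. *)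
Global Instance is_diff_linear_mx (R : realType) (m n : nat) (W : normedModType R)
    (g : {linear 'M[R]_(m, n) -> W}) (x : 'M[R]_(m, n)) : is_diff x g g.
Proof.
have dg y : differentiable g y.
  have -> : (g : 'M[R]_(m, n) -> W) =
      \sum_i \sum_j (fun z : 'M[R]_(m, n) => z i j *: g (delta_mx i j)).
    apply/funext => z; rewrite {1}[z]matrix_sum_delta linear_sum fct_sumE.
    apply: eq_bigr => i _; rewrite linear_sum fct_sumE.
    by apply: eq_bigr => j _; rewrite linearZ.
  apply: differentiable_sum => i; apply: differentiable_sum => j.
  exact/differentiableZl/differentiable_coord.
have cg : continuous g by move=> y; apply: differentiable_continuous.
by apply: DiffDef (dg x) _; rewrite diff_lin.
Qed.

Global Instance is_diff_coord (R : realType) (m n : nat) (i : 'I_m) (j : 'I_n)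
    (x : 'M[R]_(m, n)) :
  is_diff x (fun A : 'M[R]_(m, n) => A i j) (fun A => A i j).
Proof.
have lin : linear (fun A : 'M[R]_(m, n) => A i j : R^o).
  by move=> k A B; rewrite !mxE.
pose g : {linear 'M[R]_(m, n) -> R^o} :=
  HB.pack (fun A : 'M[R]_(m, n) => A i j : R^o) (GRing.isLinear.Build _ _ _ _ _ lin).
exact: (is_diff_linear_mx R m n R^o g x).
Qed.

Lemma is_diff_cjacobian (R : realType) (n m : nat) (g : 'cV[R]_n -> 'cV[R]_m)
    (x : 'cV[R]_n) (A : 'M[R]_(m, n)) :
  is_diff x g (mulmx A) -> cjacobian g x = A.
Proof.
by move=> dg; apply/matrixP => i j; rewrite mxE diff_val -colE mxE.
Qed.

(** By linearity, ['d g x] is determined by its values on the basis vectors [delta_mx j 0], which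
    form the columns of the Jacobian. *)
Lemma mul_cjacobian (R : realType) (n m : nat) (g dg : 'cV[R]_n -> 'cV[R]_m)
    (x v : 'cV[R]_n) :
  is_diff x g dg -> cjacobian g x *m v = dg v.
Proof.
move=> dgx; transitivity ('d g x v); last by rewrite diff_val.
rewrite [v in RHS]matrix_sum_delta linear_sum; apply/colP => i.
rewrite mxE summxE; apply: eq_bigr => j _.
by rewrite big_ord1 linearZ !mxE mulrC.
Qed.

Lemma is_diff_derive1 (R : realType) (W : normedModType R) (g dg : R -> W) (x : R) :
  is_diff x g dg -> derive1 g x = dg 1.
Proof. by move=> dgx; rewrite derive1E' ?diff_val//; exact: ex_diff. Qed.

Theorem lemma3p3 (R : realType) (nx : nat)
  (f : 'cV[R]_nx -> R -> R -> 'cV[R]_nx) (a : R)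
  (xeq : 'cV[R]_nx) (mueq : R)
  (f_C1 : continuously_differentiable
     (fun p : 'cV[R]_nx * R * R => f p.1.1 p.1.2 p.2))
  (f_eq : f xeq mueq 0 = 0) :
  let f_x : 'M[R]_nx := cjacobian (fun x => f x mueq 0) xeq in
  let f_mu : 'cV[R]_nx := derive1 (fun mu : R => f xeq mu 0) mueq in
  let f_u : 'cV[R]_nx := derive1 (fun u : R => f xeq mueq u) 0 in
  let R_u : 'M[R]_nx := krylov_mx f_x f_u in
  let R_mu : 'M[R]_nx := krylov_mx f_x f_mu in
  a *: (f_x *m R_u) + R_mu \in unitmx ->
  controllable_equilibrium (extended_system f a) (col_mx xeq mueq%:M).
Proof.
move=> f_x f_mu f_u R_u R_mu uW.
pose G (p : 'cV[R]_nx * R * R) := f p.1.1 p.1.2 p.2.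
pose L : 'cV[R]_nx * R * R -> 'cV[R]_nx := 'd G (xeq, mueq, 0).
have dG : is_diff (xeq, mueq, 0) G L.
  by apply: DiffDef => //; exact: f_C1.1.
have Lsplit p q r : L (p, q, r) = f_x *m p + q *: f_mu + r *: f_u.
  have dx : is_diff xeq (fun x => f x mueq 0) (fun y => L (y, 0, 0)).
    rewrite -[fun x => _]/(G \o (fun x => (x, cst mueq x, cst 0 x))).
    exact: is_diff_eq.
  have dmu : is_diff mueq (fun mu => f xeq mu 0) (fun y : R => L (0, y, 0)).
    rewrite -[fun mu => _]/(G \o (fun mu => (cst xeq mu, mu, cst 0 mu))).
    exact: is_diff_eq.
  have du : is_diff 0 (fun u => f xeq mueq u) (fun y : R => L (0, 0, y)).
    rewrite -[fun u => _]/(G \o (fun u => (cst xeq u, cst mueq u, u))).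
    exact: is_diff_eq.
  rewrite (mul_cjacobian _ _ _ _ _ _ _ dx) /f_mu /f_u.
  rewrite (is_diff_derive1 _ _ _ _ _ dmu) (is_diff_derive1 _ _ _ _ _ du).
  rewrite /L -!linearZ -!linearD; congr ('d G _ _).
  by congr (_, _, _) => /=; rewrite ?scaler0 ?addr0 ?add0r ?[_%:A]mulr1.
split.
  rewrite /equilibrium /extended_system col_mxKu col_mxKd !mxE mulr1n mulr0.
  by rewrite f_eq col_mx0.
(* Stacking and unstacking are expressed by linear maps, so that the extended system becomes a sum
   of compositions to which the chain rule applies. *)
pose Cu : {linear 'cV[R]_nx -> 'cV[R]_(nx + 1)} := mulmx (col_mx 1%:M 0).
pose Cd : {linear 'cV[R]_1 -> 'cV[R]_(nx + 1)} := mulmx (col_mx 0 1%:M).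
pose Du : {linear 'cV[R]_(nx + 1) -> 'cV[R]_nx} := usubmx.
have CudE x y : col_mx x y = Cu x + Cd y.
  by rewrite /= !mul_col_mx !mul1mx !mul0mx add_col_mx addr0 add0r.
have CuE x : Cu x = col_mx x 0 by rewrite CudE linear0 addr0.
(* State derivative: the third argument of [f] stays at 0, so [f_u] does not enter, and the
   integrator component is the constant input, whence the zero bottom row. *)
rewrite (_ : cjacobian _ _ = block_mx f_x f_mu 0 0); last first.
  apply: is_diff_cjacobian.
  pose h (z : 'cV[R]_(nx + 1)) := (Du z, z (rshift nx 0) 0, cst (0 : R) z).
  have -> : (fun z => extended_system f a z 0) = (Cu \o (G \o h)) + cst (Cd 0).
    apply/funext => z; rewrite fctE /= -CudE /extended_system /G /=.
    by rewrite [X in a * X]mxE mulr0 [dsubmx z 0 0]mxE.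
  have dGh : is_diff (h (col_mx xeq mueq%:M)) G L.
    by rewrite /h /= col_mxKu col_mxEd mxE mulr1n.
  have dh : is_diff (col_mx xeq mueq%:M) h (fun v => (Du v, v (rshift nx 0) 0, 0)).
    exact: is_diff_pair.
  apply: is_diff_eq (is_diffD (is_diff_comp (is_diff_comp dh dGh) _) _) _.
  apply/funext => v.
  rewrite fctE /= addr0 CuE Lsplit scale0r addr0 -[in RHS](vsubmxK v).
  rewrite mul_block_col !mul0mx addr0 [dsubmx v]mx11_scalar mul_mx_scalar.
  by rewrite [dsubmx v 0 0]mxE.
(* Input derivative: the state is frozen, the inner map [a *: u 0 0] brings the factor [a], and the
   integrator contributes the identity through [Cd]. *)
rewrite (_ : cjacobian _ _ = col_mx (a *: f_u) 1%:M); last first.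
  apply: is_diff_cjacobian.
  pose h (u : 'cV[R]_1) := (cst xeq u, cst mueq u, a *: u 0 0).
  have -> : (fun u => extended_system f a (col_mx xeq mueq%:M) u) =
      (Cu \o (G \o h)) + Cd.
    apply/funext => u; rewrite fctE -CudE /extended_system /G /=.
    by rewrite col_mxKu col_mxKd !mxE mulr1n.
  have dGh : is_diff (h 0) G L by rewrite /h mxE scaler0.
  have dh : is_diff 0 h (fun v => (0, 0, a *: v 0 0)).
    by apply: is_diff_pair; exact: is_diffZ.
  apply: is_diff_eq (is_diffD (is_diff_comp (is_diff_comp dh dGh) _) _) _.
  apply/funext => v.
  rewrite fctE /= -CudE Lsplit mulmx0 scale0r !add0r.
  rewrite mul_col_mx mul1mx [v in _ *m v]mx11_scalar mul_mx_scalar scalerA.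
  by rewrite [_ * a]mulrC.
apply: controllable_integrator.
by rewrite krylov_mxD -scalemxAr krylov_mxZ krylov_mxM.
Qed.
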